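(* Let $a=(a_i)_{i\in\mathbb Z}$ be a sequence in $\Bbbk$. For any $n\ge1$, in $\mathrm{Sym}^a$, $$\Psi_{n;a}=|A|_{1n},\qquad \Psi_{n;a}=(-1)^{n-1}|B|_{1n},\qquad nS_{n;a}^{[n-1]}=|C|_{1n},\qquad n\Lambda_{n;a}=(-1)^{n-1}|D|_{1n},$$ where $A,B,C,D$ are the following $n\times n$ matrices, all with zero entries in positions $(p,q)$ with $p>q+1$: (1) $A_{pq}=S_{q-p+1;a}^{[n-p]}$ for $p\le q\le n-1$; $A_{pn}=(n-p+1)\,S_{n-p+1;a}^{[n-p]}$ for $1\le p\le n$; $A_{q+1,q}=1$ for $1\le q\le n-1$. (2) $B_{1q}=q\,\Lambda_{q;a}^{[n-q]}$ for $1\le q\le n$; $B_{pq}=\Lambda_{q-p+1;a}^{[n-q]}$ for $2\le p\le q\le n$; $B_{q+1,q}=1$ for $1\le q\le n-1$. (3) $C_{pq}=\Psi_{q-p+1;a}^{[n-q]}$ for $p\le q$; $C_{q+1,q}=-q$ for $1\le q\le n-1$. (4) $D_{pq}=\Psi_{q-p+1;a}^{[n-q]}$ for $p\le q$; $D_{q+1,q}=n-q$ for $1\le q\le n-1$.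
   Context: $\Bbbk$ is a field of characteristic zero and $a=(a_i)_{i\in\mathbb Z}$ is a sequence in $\Bbbk$. Put $(t\downarrow a)^k=(t-a_1)\cdots(t-a_k)$, $(t\downarrow a)^0=1$, $(\tau^s a)_i=a_{i+s}$ for $s\in\mathbb Z$, and $\hat a_i=-a_{-i+1}$. $\mathrm{Sym}^a=\Bbbk\langle S_{1;a},S_{2;a},\ldots\rangle$ is the free associative unital $\Bbbk$-algebra on $S_{k;a}$, $k\ge1$. With $t$ a central variable and all expressions expanded as formal power series in $1/t$, put $\sigma^a(t)=\sum_{k\ge0}S_{k;a}/(t\downarrow a)^k$ and $\lambda^{\hat a}(t)=\sum_{k\ge0}\Lambda_{k;a}/(t\downarrow\hat a)^k$ with $S_{0;a}=\Lambda_{0;a}=1$; the elements $\Lambda_{k;a}\in\mathrm{Sym}^a$ are determined by $\lambda^{\hat a}(-t)\sigma^a(t)=\sigma^a(t)\lambda^{\hat a}(-t)=1$. Shifts: for $s\in\mathbb Z$, $S_{k;a}^{[s]}$ and $\Lambda_{k;a}^{[s]}$ are defined by $\sum_{k\ge0} S_{k;a}^{[s]}/(t\downarrow\tau^{-s}a)^k=\sum_{k\ge0}S_{k;a}/(t\downarrow a)^k$ and $\sum_{k\ge0}\Lambda_{k;a}^{[s]}/(t\downarrow\tau^{s}\hat a)^k=\sum_{k\ge0}\Lambda_{k;a}/(t\downarrow\hat a)^k$. The $a$-shifted power sums and their shifts are $\Psi_{n;a}=\sum_{k=0}^{n-1}(-1)^k(n-k)\Lambda_{k;a}^{[n-k]}S_{n-k;a}^{[n-k-1]}$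 and, for $s\in\mathbb Z$, $\Psi_{n;a}^{[s]}=\sum_{k=0}^{n-1}(-1)^k(n-k)\Lambda_{k;a}^{[n-k+s]}S_{n-k;a}^{[n-k-1+s]}$. Quasideterminants: for an $n\times n$ matrix $A$ over a unital ring such that the matrix $A^{pq}$ (delete row $p$ and column $q$) is invertible, $|A|_{pq}=a_{pq}-r(A^{pq})^{-1}c$, where $r$ is the $p$-th row of $A$ with $a_{pq}$ removed and $c$ is the $q$-th column of $A$ with $a_{pq}$ removed. (For the matrices here and $(p,q)=(1,n)$ the matrix to be inverted is upper triangular with nonzero scalars on the diagonal.) *)

(* Defs.v *)
From mathcomp Require Import all_boot all_order all_algebra.
From mathcomp.multinomials Require Import monalg.

Set Implicit Arguments.
Unset Strict Implicit.
Unset Printing Implicit Defensive.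

Import GRing.Theory.
Local Open Scope ring_scope.

(** * Formal power series in 1/t *)

(* A series [sum_n f_n t^(-n)] with coefficients in [R] is the function
   [n |-> f_n]; equality of series is [=1].  The product below is the Cauchy
   product, so [t] is central even when [R] is not commutative. *)
Definition ser (R : Type) := nat -> R.

Definition ser1 (R : nzRingType) : ser R := fun n => (n == 0%N)%:R.

Definition serM (R : nzRingType) (f g : ser R) : ser R :=
  fun n => \sum_(i < n.+1) f i * g (n - i)%N.

(* Substitution of [-t] for [t]. *)
Definition ser_opp_var (R : nzRingType) (f : ser R) : ser R :=
  fun n => (-1) ^+ n * f n.

(* [1/(t - c) = sum_(m >= 0) c^m t^(-m-1)] *)
Definition ser_inv_linear (k : fieldType) (c : k) : ser k :=
  fun n => if n is m.+1 then c ^+ m else 0.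

(* [1/(t|b)^m], where [(t|b)^m = (t - b_1) ... (t - b_m)] *)
Fixpoint ser_inv_fall (k : fieldType) (b : int -> k) (m : nat) : ser k :=
  if m is m'.+1 then serM (ser_inv_fall b m') (ser_inv_linear (b m'.+1%:Z))
  else @ser1 k.

Definition tau (T : Type) (s : int) (a : int -> T) : int -> T :=
  fun i => a (i + s).

Definition hat (k : fieldType) (a : int -> k) : int -> k :=
  fun i => - a (- i + 1).

(** * The free algebra and its distinguished elements *)

Notation Sym k := {malg k[{fmonom nat}]}.

(* The letter [j : nat] stands for the generator of index [j + 1]. *)
Definition Sgen (k : fieldType) (m : nat) : Sym k :=
  if m is j.+1 then << fmu j >> else 1.

(* [sum_(m >= 0) f_m / (t|b)^m].  Since [1/(t|b)^m] only involves [t^(-n)]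
   with [n >= m], the terms [m <= n] give the whole coefficient of [t^(-n)]. *)
Definition fall_ser (k : fieldType) (b : int -> k) (f : nat -> Sym k) :
    ser (Sym k) :=
  fun n => \sum_(m < n.+1) ser_inv_fall b m n *: f m.

Definition is_Lambda (k : fieldType) (a : int -> k) (L : nat -> Sym k) :=
  let sigma := fall_ser a (@Sgen k) in
  let lambda_opp := ser_opp_var (fall_ser (hat a) L) in
  [/\ L 0%N = 1,
      serM lambda_opp sigma =1 @ser1 (Sym k) &
      serM sigma lambda_opp =1 @ser1 (Sym k)].

(* [SS s m] is [S_m^[s]] and [LL s m] is [Lambda_m^[s]]. *)
Definition is_S_shift (k : fieldType) (a : int -> k)
    (SS : int -> nat -> Sym k) :=
  forall s, fall_ser (tau (- s) a) (SS s) =1 fall_ser a (@Sgen k).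

Definition is_Lambda_shift (k : fieldType) (a : int -> k) (L : nat -> Sym k)
    (LL : int -> nat -> Sym k) :=
  forall s, fall_ser (tau s (hat a)) (LL s) =1 fall_ser (hat a) L.

(* [Psi SS LL s n] is [Psi_n^[s]]; the unshifted [Psi_n] is the case [s = 0]. *)
Definition Psi (k : fieldType) (SS LL : int -> nat -> Sym k) (s : int)
    (n : nat) : Sym k :=
  \sum_(i < n) (-1) ^+ i *
    (LL (n%:Z - i%:Z + s) i * SS (n%:Z - i%:Z - 1 + s) (n - i)%N) *+ (n - i)%N.

(* The defining conditions are satisfied by exactly one family of elements:
   the series [1/(t|b)^m] are triangular with unit diagonal. *)

Lemma nat_rec_exists (T : Type) (x0 : T) (step : nat -> (nat -> T) -> T) :
    (forall n f g, (forall i, (i < n)%N -> f i = g i) -> step n f = step n g) ->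
  exists f, forall n, f n = step n f.
Proof.
move=> step_ext.
pose pre := fix pre n := if n is m.+1 then
  rcons (pre m) (step m (nth x0 (pre m))) else [::].
have size_pre n : size (pre n) = n.
  by elim: n => //= n IHn; rewrite size_rcons IHn.
exists (fun n => nth x0 (pre n.+1) n) => n /=.
rewrite nth_rcons size_pre ltnn eqxx; apply: step_ext => i lt_in.
elim: n lt_in => // n IHn; rewrite ltnS leq_eqVlt => /predU1P[-> //|lt_in].
by rewrite /= [in LHS]nth_rcons size_pre lt_in IHn.
Qed.

Section WellDefined.

Variables (k : fieldType) (b : int -> k).

Lemma ser_inv_fall_triangular m n : (n <= m)%N ->
  ser_inv_fall b m n = (n == m)%:R.
Proof.
elim: m n => [|m IHm] n /=; first by rewrite leqn0 => /eqP->.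
move=> le_nm; rewrite /serM big_ord_recr /= subnn mulr0 addr0.
case: n le_nm => [|n]; first by rewrite big_ord0.
rewrite ltnS eqSS => le_nm; rewrite big_ord_recr /= big1 => [|[i lt_in] _] /=.
  by rewrite add0r subSnn /= expr0 mulr1 IHm.
by rewrite IHm ?(ltnW (leq_trans lt_in le_nm)) ?ltn_eqF ?mul0r //;
  exact: leq_trans lt_in le_nm.
Qed.

Lemma fall_serE (f : nat -> Sym k) n :
  fall_ser b f n = \sum_(m < n) ser_inv_fall b m n *: f m + f n.
Proof.
by rewrite /fall_ser big_ord_recr /= ser_inv_fall_triangular // eqxx scale1r.
Qed.

Lemma fall_ser_exists (F : ser (Sym k)) : exists f, fall_ser b f =1 F.
Proof.
have [|f fE] := @nat_rec_exists (Sym k) 0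
  (fun n f => F n - \sum_(m < n) ser_inv_fall b m n *: f m).
  by move=> n f g efg; congr (_ - _); apply: eq_bigr => i _; rewrite efg.
by exists f => n; rewrite fall_serE [X in _ + X]fE addrC subrK.
Qed.

Lemma fall_ser_inj (f g : nat -> Sym k) :
  fall_ser b f =1 fall_ser b g -> f =1 g.
Proof.
move=> efg n; elim/ltn_ind: n => n IHn; move: (efg n); rewrite !fall_serE.
rewrite (eq_bigr (fun m : 'I_n => ser_inv_fall b m n *: g m)) => [/addrI //|].
by move=> i _; rewrite IHn.
Qed.

End WellDefined.

Section SeriesInverse.

Variable R : nzRingType.
Implicit Types f g h : ser R.

Lemma serM_poly f g (N n : nat) : (n < N)%N ->
  serM f g n = ((\poly_(i < N) f i) * (\poly_(i < N) g i))`_n.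
Proof.
move=> lt_nN; rewrite coefM; apply: eq_bigr => -[i /= lt_in] _.
by rewrite !coef_poly (leq_trans lt_in) // (leq_ltn_trans (leq_subr _ _)).
Qed.

Lemma serMA f g h : serM (serM f g) h =1 serM f (serM g h).
Proof.
move=> n; have trunc (p : {poly R}) (u : ser R) :
    (forall i, (i <= n)%N -> u i = p`_i) ->
  forall i, (i <= n)%N -> (\poly_(j < n.+1) u j)`_i = p`_i.
  by move=> up i le_in; rewrite coef_poly ltnS le_in up.
rewrite !(serM_poly _ _ (ltnSn n)).
transitivity (((\poly_(i < n.+1) f i) * (\poly_(i < n.+1) g i) *
  (\poly_(i < n.+1) h i))`_n).
  rewrite !coefM; apply: eq_bigr => -[i /= le_in] _; congr (_ * _).
  by apply: trunc => // j le_jn; rewrite (serM_poly _ _ (N := n.+1)).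
rewrite -mulrA !coefM; apply: eq_bigr => -[i /= le_in] _; congr (_ * _).
apply/esym/trunc; last exact: leq_subr.
by move=> j le_jn; rewrite (serM_poly _ _ (N := n.+1)).
Qed.

Lemma eq_serM f f' g g' : f =1 f' -> g =1 g' -> serM f g =1 serM f' g'.
Proof. by move=> ff gg n; apply: eq_bigr => i _; rewrite ff gg. Qed.

Lemma ser1M f : serM (@ser1 R) f =1 f.
Proof.
move=> n; rewrite /serM big_ord_recl /= subn0 mul1r big1 ?addr0 // => i _.
by rewrite mul0r.
Qed.

Lemma serM1 f : serM f (@ser1 R) =1 f.
Proof.
move=> n; rewrite /serM big_ord_recr /= subnn mulr1 big1 ?add0r // => i _.
by rewrite /ser1 subn_eq0 leqNgt ltn_ord mulr0.
Qed.

Lemma ser_inv_unique f g h :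
  serM g f =1 @ser1 R -> serM f h =1 @ser1 R -> g =1 h.
Proof.
move=> gf fh n; rewrite -(serM1 g n) -(eq_serM (frefl g) fh n) -serMA.
by rewrite (eq_serM gf (frefl h) n) ser1M.
Qed.

Lemma ser_inv_exists f : f 0%N = 1 ->
  exists g, serM g f =1 @ser1 R /\ serM f g =1 @ser1 R.
Proof.
move=> f0.
have [|g gE] := @nat_rec_exists R 0
  (fun n g => (n == 0%N)%:R - \sum_(i < n) g i * f (n - i)%N).
  by move=> n u v euv; congr (_ - _); apply: eq_bigr => i _; rewrite euv.
have [|h hE] := @nat_rec_exists R 0
  (fun n h => (n == 0%N)%:R - \sum_(i < n) f i.+1 * h (n - i.+1)%N).
  case=> [|n] u v euv; first by rewrite !big_ord0.
  congr (_ - _); apply: eq_bigr => i _.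
  by rewrite euv // ltnS subSS leq_subr.
have gf : serM g f =1 @ser1 R.
  by move=> n; rewrite /serM big_ord_recr /= subnn f0 mulr1 gE addrC subrK.
have fh : serM f h =1 @ser1 R.
  by move=> n; rewrite /serM big_ord_recl /= subn0 f0 mul1r hE subrK.
have gh := ser_inv_unique gf fh.
by exists g; split=> // n; rewrite (eq_serM (frefl f) gh n) fh.
Qed.

Lemma ser_opp_varK f : ser_opp_var (ser_opp_var f) =1 f.
Proof. by move=> n; rewrite /ser_opp_var mulrA -expr2 sqrr_sign mul1r. Qed.

Lemma ser_opp_var_inj f g : ser_opp_var f =1 ser_opp_var g -> f =1 g.
Proof.
move=> efg n; rewrite -(ser_opp_varK f) -(ser_opp_varK g).
by rewrite /ser_opp_var; congr (_ * _); apply: efg.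
Qed.

End SeriesInverse.

Lemma Lambda_exists (k : fieldType) (a : int -> k) : exists L, is_Lambda a L.
Proof.
have sigma0 : fall_ser a (@Sgen k) 0%N = 1 by rewrite fall_serE big_ord0 add0r.
have [g [gs sg]] := ser_inv_exists sigma0.
have [L LE] := fall_ser_exists (hat a) (ser_opp_var g).
have lamE : ser_opp_var (fall_ser (hat a) L) =1 g.
  by move=> n; rewrite -[RHS]ser_opp_varK /ser_opp_var LE.
exists L; split.
- have := gs 0%N; rewrite /serM big_ord1 sigma0 mulr1 -lamE /ser_opp_var.
  by rewrite expr0 mul1r fall_serE big_ord0 add0r.
- by move=> n; rewrite (eq_serM lamE (frefl _) n) gs.
- by move=> n; rewrite (eq_serM (frefl _) lamE n) sg.
Qed.

Lemma Lambda_unique (k : fieldType) (a : int -> k) (L L' : nat -> Sym k) :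
  is_Lambda a L -> is_Lambda a L' -> L =1 L'.
Proof.
move=> [_ Ls _] [_ _ sL']; apply: (@fall_ser_inj k (hat a)).
exact/ser_opp_var_inj/(ser_inv_unique Ls sL').
Qed.

(** * Quasideterminants *)

(* [x] is the quasideterminant [|A|_pq]; in particular it is defined, i.e.
   the minor has a two-sided inverse [M].  The ring need not be commutative,
   hence [invmx] is not available. *)
Definition is_quasidet (R : nzRingType) (n : nat) (A : 'M[R]_n)
    (p q : 'I_n) (x : R) :=
  exists M : 'M[R]_(n.-1),
    [/\ row' p (col' q A) *m M = 1%:M,
        M *m row' p (col' q A) = 1%:M &
        x = A p q - (col' q (row p A) *m M *m row' p (col q A)) 0 0].

Lemma quasidet_unique (R : nzRingType) (n : nat) (A : 'M[R]_n) (p q : 'I_n)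
    (x y : R) :
  is_quasidet A p q x -> is_quasidet A p q y -> x = y.
Proof.
move=> [M [_ MA ->]] [M' [AM' _ ->]]; congr (_ - (_ *m _ *m _) _ _).
by rewrite -[LHS]mulmx1 -AM' mulmxA MA mul1mx.
Qed.

(** * The four matrices *)

(* The matrix with entry [E p q] in row [p] and column [q], counted from 1. *)
Definition mx_from1 (R : Type) (n : nat) (E : nat -> nat -> R) : 'M[R]_n :=
  \matrix_(i, j) E i.+1 j.+1.

Definition matA (k : fieldType) (SS : int -> nat -> Sym k) (n : nat) :
    'M[Sym k]_n :=
  mx_from1 n (fun p q =>
    if (p <= q)%N then
      if q == n then SS (n%:Z - p%:Z) (n - p + 1)%N *+ (n - p + 1)%N
      else SS (n%:Z - p%:Z) (q - p + 1)%N
    else if p == q.+1 then 1 else 0).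

Definition matB (k : fieldType) (LL : int -> nat -> Sym k) (n : nat) :
    'M[Sym k]_n :=
  mx_from1 n (fun p q =>
    if (p <= q)%N then
      if p == 1%N then LL (n%:Z - q%:Z) q *+ q
      else LL (n%:Z - q%:Z) (q - p + 1)%N
    else if p == q.+1 then 1 else 0).

Definition matC (k : fieldType) (SS LL : int -> nat -> Sym k) (n : nat) :
    'M[Sym k]_n :=
  mx_from1 n (fun p q =>
    if (p <= q)%N then Psi SS LL (n%:Z - q%:Z) (q - p + 1)%N
    else if p == q.+1 then - q%:R else 0).

Definition matD (k : fieldType) (SS LL : int -> nat -> Sym k) (n : nat) :
    'M[Sym k]_n :=
  mx_from1 n (fun p q =>
    if (p <= q)%N then Psi SS LL (n%:Z - q%:Z) (q - p + 1)%N
    else if p == q.+1 then (n - q)%:R else 0).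

(* Main.v *)
Require Import Defs.
From mathcomp Require Import all_boot all_order all_algebra.
From mathcomp.multinomials Require Import monalg.
From mathcomp Require Import zify.

Set Implicit Arguments.
Unset Strict Implicit.
Unset Printing Implicit Defensive.

Import GRing.Theory.
Local Open Scope ring_scope.

(** Let [v_j] be the family of products of linear factors with
    [v_(j+1) = (t - w_j) v_j].  Multiplication by a series [f] in [1/t] sends
    [v_j] to a combination of the [v_i] with [i <= j], and composition of
    multiplications is multiplication of matrices ([ser_mxM]).  Take the indices
    from 0 to [N], the size of the matrices of the theorem.  With
    [w_j = a_(j+1-N)], the matrix [H] of sigma has the shifted complete
    elements [S_(j-i)^[N-i-1]] as entries and the matrix [E] of its inverse
    has the shifted elementary elements
    [(-1)^(j-i) Lambda_(j-i)^[N-j]] ([ser_entry_sigma], [ser_entry_lambda]):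
    the coefficient of [1/(t|b)^m] in a series is a residue, and so is each
    matrix entry, of the same series against the same linear factors.  Hence
    all the shifts are absorbed in one identity, [E H = H E = 1].

    Let [D] be the diagonal matrix of the indices.  The definition of the power
    sums says that [E (H D - D H)] has the entries [Psi_(j-i)^[N-j]]
    ([conj_index_Psi]).  Call this matrix [P].  Since [H] and [E] are inverse to
    each other, [P = D - E D H], [H P = H D - D H] and [P E = D E - E D]; these
    are noncommutative Newton identities.

    Each of the four matrices of the theorem is an upper triangular matrix [X]
    without its last row and its first column.  For such a corner, a row [y]
    that starts with 1 and for which [y X] vanishes at all inner columns
    exhibits the quasideterminant as an entry of [y X] corrected by a diagonal
    entry of [X] ([corner_quasidet_row]); a column serves in the same way
    ([corner_quasidet_col]).  The rows and columns are the first row of [E] for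
    the first matrix, the last column of [H] with alternating signs for the
    second, the first row of [H] for the third and the last column of [E] for
    the fourth; they annihilate what they should by [E H = 1] and by the Newton
    identities.  Characteristic zero makes the subdiagonal entries of the third
    and fourth matrices invertible. *)

(** * Multiplication of series by linear factors *)

Section MulXsub.

Variables (k : fieldType) (V : lmodType k).
Implicit Types (c : k) (s : seq k) (f g : ser V).

(** The product [(t - c) f] without its term in [t].  That term stays divisible
    by [t] when further linear factors are multiplied in, so it can be dropped
    at each step: [mulXsubs s f] has the coefficients of [t^(-n)], [n >= 0], of
    the full product of [f] with the factors [t - c], [c] in [s]. *)
Definition mulXsub c f : ser V := fun n => f n.+1 - c *: f n.

Definition mulXsubs s f : ser V := foldr mulXsub f s.

(** The coefficient of [1/t] in the product of [f] with the factors [t - c]. *)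
Definition residue s f : V := mulXsubs s f 1%N.

Lemma mulXsubs_rcons s c f : mulXsubs (rcons s c) f = mulXsubs s (mulXsub c f).
Proof. exact: foldr_rcons. Qed.

Lemma mulXsubs_cat s s' f : mulXsubs (s ++ s') f = mulXsubs s (mulXsubs s' f).
Proof. exact: foldr_cat. Qed.

Lemma eq_mulXsubs_le s f g n :
    (forall i, (i <= n + size s)%N -> f i = g i) ->
  mulXsubs s f n = mulXsubs s g n.
Proof.
elim: s n => [|c s IHs] n fg /=; first by rewrite fg ?addn0.
rewrite /mulXsub; congr (_ - _ *: _); apply: IHs => i le_i; apply: fg.
  by rewrite addnS -addSn.
by rewrite addnS (leq_trans le_i).
Qed.

Lemma eq_mulXsubs s f g : f =1 g -> mulXsubs s f =1 mulXsubs s g.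
Proof. by move=> fg n; apply: eq_mulXsubs_le. Qed.

Lemma mulXsubs_comm c s f :
  mulXsubs s (mulXsub c f) =1 mulXsub c (mulXsubs s f).
Proof.
elim: s => //= d s IHs n; rewrite /mulXsub !IHs /mulXsub.
rewrite !scalerBr !scalerA (mulrC d c) !opprB !addrA.
by rewrite [LHS]addrAC [RHS]addrAC; congr (_ + _); rewrite addrAC.
Qed.

Lemma mulXsubs_catC s s' f : mulXsubs (s ++ s') f =1 mulXsubs (s' ++ s) f.
Proof.
elim: s' s f => [|c s' IHs'] s f n; first by rewrite cats0.
by rewrite -cat_rcons IHs' -rcons_cat mulXsubs_rcons mulXsubs_comm.
Qed.

Lemma mulXsubs_rev s f : mulXsubs (rev s) f =1 mulXsubs s f.
Proof.
elim: s f => //= c s IHs f n.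
by rewrite rev_cons mulXsubs_rcons IHs mulXsubs_comm.
Qed.

(** A product of linear factors is monic, so the highest power of [t] in its
    product with [f] comes from the highest power of [t] in [f]. *)
Lemma mulXsubs_lead s f n :
    (forall i, (i < n + size s)%N -> f i = 0) ->
  mulXsubs s f n = f (n + size s)%N.
Proof.
elim: s n => [|c s IHs] n f0 /=; first by rewrite addn0.
rewrite /mulXsub IHs => [|i lt_i]; last by rewrite f0 // addnS -addSn.
rewrite IHs => [|i lt_i]; last by rewrite f0 // addnS (leq_trans lt_i).
by rewrite (f0 (n + _)%N) ?addnS // scaler0 subr0 addSn.
Qed.

Lemma mulXsubs_eq0 s f n : (forall i, (n <= i)%N -> f i = 0) ->
  mulXsubs s f n = 0.
Proof.
elim: s n => [|c s IHs] n f0 /=; first exact: f0.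
rewrite /mulXsub !IHs ?scaler0 ?subr0 // => i /ltnW; exact: f0.
Qed.

End MulXsub.

Lemma mulXsubs_lincomb (k : fieldType) (V : lmodType k) s M
    (u : nat -> ser k) (f : nat -> V) n :
  mulXsubs s (fun n => \sum_(m < M) u m n *: f m) n =
  \sum_(m < M) mulXsubs s (u m : ser k^o) n *: f m.
Proof.
elim: s n => //= c s IHs n; rewrite /mulXsub !IHs scaler_sumr -sumrB.
by apply: eq_bigr => m _; rewrite scalerBl scalerA.
Qed.

(** * Coefficients of a series in falling powers are residues *)

Section FallingCoefficients.

Variables (k : fieldType) (b : int -> k).

Let bs m := [seq b l.+1%:Z | l <- iota 0 m].

Lemma mulXsub_inv_linear (u : ser k) c :
  mulXsub c (serM u (ser_inv_linear c) : ser k^o) =1 u.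
Proof.
move=> n; rewrite /mulXsub /serM !big_ord_recr /= !subnn !mulr0 !addr0.
rewrite subSnn /= expr0 mulr1 addrAC scaler_sumr -sumrB big1 ?add0r // => i _.
rewrite subSn 1?ltnW // -(subnSK (ltn_ord i)) /=.
by rewrite exprS [X in _ - X]mulrCA subrr.
Qed.

Lemma mulXsubs_inv_fall m n :
  mulXsubs (bs m) (ser_inv_fall b m : ser k^o) n = @ser1 k n.
Proof.
elim: m => [|m IHm] //; rewrite /bs -[in iota _ _]addn1 iotaD map_cat cats1.
by rewrite mulXsubs_rcons (eq_mulXsubs _ (mulXsub_inv_linear _ _)).
Qed.

(** The product of [N] linear factors with [1/(t|b)^m] is a polynomial for
    [m <= N], is [1/(t - b_m)] for [m = N + 1], and starts at [t^(-2)] or later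
    for larger [m]. *)
Lemma residue_inv_fall m N :
  residue (bs N) (ser_inv_fall b m : ser k^o) = (m == N.+1)%:R.
Proof.
have size_bs : size (bs N) = N by rewrite size_map size_iota.
rewrite /residue; have [le_mN|lt_Nm] := leqP m N.
  rewrite ltn_eqF // -(subnKC le_mN) /bs iotaD map_cat mulXsubs_catC.
  rewrite mulXsubs_cat mulXsubs_eq0 // => -[//|i] _.
  by rewrite mulXsubs_inv_fall.
rewrite mulXsubs_lead size_bs add1n => [|i lt_iN].
  by rewrite ser_inv_fall_triangular // eq_sym.
have lt_im := leq_trans lt_iN lt_Nm.
by rewrite ser_inv_fall_triangular ?ltn_eqF // ltnW.
Qed.

(** Linear combination of the orthogonality relations [residue_inv_fall]. *)
Lemma fall_ser_coef (f : nat -> Sym k) N :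
  f N.+1 = residue (bs N) (fall_ser b f).
Proof.
have size_bs : size (bs N) = N by rewrite size_map size_iota.
rewrite /residue.
(* The residue involves the coefficients of index at most N + 1; for them the
   sum over m can be given the same bound. *)
rewrite (@eq_mulXsubs_le _ _ _ _
    (fun n => \sum_(m < N.+2) ser_inv_fall b m n *: f m)).
  rewrite mulXsubs_lincomb -[LHS]add0r big_ord_recr.
  congr (_ + _); last by rewrite [X in X *: _]residue_inv_fall eqxx scale1r.
  rewrite big1 // => i _; rewrite [X in X *: _]residue_inv_fall.
  by rewrite ltn_eqF ?scale0r //; apply: (ltn_ord i).
rewrite size_bs add1n => i le_iN; rewrite /fall_ser.
rewrite (big_ord_widen N.+2 (fun m => ser_inv_fall b m i *: f m)) //.
rewrite [RHS](bigID (fun m : 'I__ => (m < i.+1)%N)) /=.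
rewrite [X in _ = _ + X]big1 ?addr0 // => m; rewrite -leqNgt => lt_im.
by rewrite ser_inv_fall_triangular ?(ltnW lt_im) // ltn_eqF ?scale0r.
Qed.

End FallingCoefficients.

(** * The matrix of multiplication by a series *)

Lemma big_ord_support (V : nmodType) (N i j : nat) (F : nat -> V) :
    (j <= N)%N -> (forall r, (r < i)%N || (j <= r)%N -> F r = 0) ->
  \sum_(r < N) F r = \sum_(r < j - i) F (i + r)%N.
Proof.
move=> le_jN F0; have [le_ij|lt_ji] := leqP i j; last first.
  have /eqP-> : (j - i == 0)%N by rewrite subn_eq0 ltnW.
  rewrite big_ord0 big1 // => r _; apply: F0.
  by case: ltnP => //= le_ir; rewrite (leq_trans (ltnW lt_ji)).
rewrite -(big_mkord xpredT F).
rewrite (@big_cat_nat _ _ _ i) ?(leq_trans le_ij) //=.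
rewrite big_nat big1 ?add0r => [|r /andP[_ lt_ri]]; last by rewrite F0 ?lt_ri.
rewrite (@big_cat_nat _ _ _ j) //=.
rewrite [X in _ + X]big_nat [X in _ + X]big1 ?addr0 => [|r /andP[le_jr _]].
  rewrite -{1}[i]add0n big_addn big_mkord.
  by apply: eq_bigr => r _; rewrite addnC.
by rewrite F0 ?le_jr ?orbT.
Qed.

Section SeriesMatrix.

Variables (k : fieldType) (R : lalgType k).
Hypothesis R_scalerAr : forall (c : k) (x y : R), c *: (x * y) = x * (c *: y).
Implicit Types (c : k) (s : seq k) (f g : ser R).

(** The last term is the contribution to [g (t - c) f] of the term [t f_0] that
    is dropped from [(t - c) f]. *)
Lemma mulXsub_serM c g f n :
  mulXsub c (serM g f) n = serM g (mulXsub c f) n + g n.+1 * f 0%N.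
Proof.
rewrite /mulXsub /serM big_ord_recr /= subnn addrAC; congr (_ + _).
rewrite scaler_sumr -sumrB; apply: eq_bigr => i _.
by rewrite subSn ?mulrBr ?R_scalerAr // -ltnS ltn_ord.
Qed.

(** For [g] and [f] without constant terms this expresses a divided
    difference: if [p(t)] is the product of the linear
    factors, then the residue of [p g f] is obtained by applying the residue
    functionals of [g] and [f] to the two variables of
    [(p(x) - p(y)) / (x - y)], which is the sum over [r] of the products of the
    first [r] factors at [x] and of the factors after position [r] at [y].
    The proof takes off the factors one by one from the right. *)
Lemma residue_serM s g f :
  residue s (serM g f) =
    g 0%N * residue s f
    + \sum_(r < size s) residue (take r s) g * residue (drop r.+1 s) f
    + residue s g * f 0%N.
Proof.
have mulXsubs_addM t h (h' : ser R) x n :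
    mulXsubs t (fun n => h n + h' n * x) n
    = mulXsubs t h n + mulXsubs t h' n * x.
  elim: t n => //= c t IHt n; rewrite /mulXsub !IHt.
  by rewrite scalerDr mulrBl -scalerAl opprD addrACA.
have mulXsubs_succ t h n : mulXsubs t (fun n => h n.+1) n = mulXsubs t h n.+1.
  by elim: t n => //= c t IHt n; rewrite /mulXsub !IHt.
elim/last_ind: s f => [|s c IHs] f.
  by rewrite /residue /= /serM big_ord0 addr0 !big_ord_recl big_ord0 addr0.
rewrite /residue !mulXsubs_rcons (eq_mulXsubs _ (mulXsub_serM _ _ _)).
rewrite mulXsubs_addM [X in X + _]IHs size_rcons big_ord_recr /=.
rewrite -cats1 take_size_cat // drop_oversize ?size_cat ?addn1 //= cats1.
under [in RHS]eq_bigr => r _.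
  rewrite -cats1 takel_cat ?(ltnW (ltn_ord r)) // cats1.
  rewrite drop_rcons ?ltn_ord // mulXsubs_rcons; over.
rewrite /= -!addrA; congr (_ + (_ + _)).
rewrite mulXsubs_succ mulXsubs_comm /mulXsub mulrBr mulrBl.
by rewrite -scalerAl R_scalerAr -addrA; congr (_ + _); rewrite addrC.
Qed.

(** Substituting [-t] for [t] turns [t - c] into [-(t + c)]. *)
Lemma mulXsubs_opp_var s f n :
  mulXsubs s (ser_opp_var f) n =
  (-1) ^+ (size s + n) * mulXsubs [seq - c | c <- s] f n.
Proof.
elim: s n => [|c s IHs] n //=; rewrite /mulXsub !IHs addnS !addSn !exprS.
by rewrite scaleNr opprK mulrDr !mulN1r !mulNr -R_scalerAr.
Qed.

Definition window (w : nat -> k) (i j : nat) : seq k :=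
  [seq w l | l <- iota i.+1 (j - i.+1)].

(** The coefficient of [v_i] in [f v_j], where [v_(l+1) = (t - w_l) v_l].  For
    [i < j] it is the residue of [f v_j / v_(i+1)], whose linear factors are
    those of index strictly between [i] and [j]. *)
Definition ser_entry (w : nat -> k) f (i j : nat) : R :=
  if (i < j)%N then residue (window w i j) f else f 0%N *+ (i == j).

Definition ser_mx (w : nat -> k) N f : 'M[R]_N :=
  \matrix_(i, j) ser_entry w f i j.

Lemma ser_entry_lt0 w f i j : (j < i)%N -> ser_entry w f i j = 0.
Proof. by move=> lt_ji; rewrite /ser_entry ltnNge ltnW //= gtn_eqF. Qed.

Lemma ser_entry_diag w f i : ser_entry w f i i = f 0%N.
Proof. by rewrite /ser_entry ltnn eqxx. Qed.

(** Composition of multiplications, restricted to a window of [N] consecutive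
    basis vectors; triangularity keeps the sums inside the window.  Entrywise
    this is [residue_serM]. *)
Lemma ser_mxM w N g f :
  ser_mx w N (serM g f) = ser_mx w N g *m ser_mx w N f.
Proof.
apply/matrixP => i j; rewrite !mxE.
under eq_bigr => r _ do rewrite !mxE.
have [lt_ij|lt_ji|eq_ij] := ltngtP i j.
- rewrite (@big_ord_support _ N i j.+1
    (fun r => ser_entry w g i r * ser_entry w f r j)) //.
    rewrite subSn ?(ltnW lt_ij) // -subnSK // big_ord_recl big_ord_recr /=.
    rewrite addn0 /bump add1n addnS -addSn subnKC // !ser_entry_diag addrA.
    rewrite /ser_entry lt_ij residue_serM.
    congr (_ + _ + _); rewrite size_map size_iota; apply: eq_bigr => r _.
    rewrite add1n addnS -addSn.
    have lt_rj : (i.+1 + r < j)%N by rewrite -ltn_subRL ltn_ord.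
    rewrite lt_rj addSn ltnS leq_addr; congr (residue _ _ * residue _ _).
      rewrite -map_take take_iota (minn_idPl (ltnW (ltn_ord r))).
      by rewrite /window subSS addKn.
    by rewrite -map_drop drop_iota /window addnS addSn -subnDA addnS addSn.
  move=> r /orP[lt_ri|lt_jr]; first by rewrite ser_entry_lt0 ?mul0r.
  by rewrite [X in _ * X]ser_entry_lt0 ?mulr0.
- rewrite ser_entry_lt0 // big1 // => r _.
  have [lt_ri|le_ir] := ltnP r i; first by rewrite ser_entry_lt0 ?mul0r.
  by rewrite [X in _ * X]ser_entry_lt0 ?mulr0 // (leq_trans lt_ji).
- rewrite -eq_ij (bigD1 i) //= !ser_entry_diag big1 => [|r ne_ri].
    by rewrite addr0 /serM big_ord1.
  have [lt_ri|lt_ir|/val_inj eq_ri] := ltngtP r i.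
  + by rewrite ser_entry_lt0 ?mul0r.
  + by rewrite [X in _ * X]ser_entry_lt0 ?mulr0.
  + by rewrite eq_ri eqxx in ne_ri.
Qed.

Lemma eq_ser_mx w N f g : f =1 g -> ser_mx w N f = ser_mx w N g.
Proof.
move=> fg; apply/matrixP => i j; rewrite !mxE /ser_entry /residue.
by rewrite (eq_mulXsubs _ fg) fg.
Qed.

Lemma ser_mx1 w N : ser_mx w N (@ser1 R) = 1%:M.
Proof.
apply/matrixP => i j; rewrite !mxE /ser_entry.
have [lt_ij|_] := ltnP i j; last by [].
rewrite -val_eqE /= ltn_eqF //; by apply: mulXsubs_eq0; case.
Qed.

End SeriesMatrix.

(** Over a commutative ring of scalars the scalars are central, whether or not
    the monomials commute. *)
Lemma malg_scalerAr (k : comNzRingType) (M : monomType) (c : k)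
    (x y : {malg k[M]}) :
  c *: (x * y) = x * (c *: y).
Proof.
rewrite -!mul_malgC mulrA [RHS]mulrA; congr (_ * y).
rewrite mul_malgC malgZ_def malgM_def fgmulgU.
by apply: eq_bigr => i _; rewrite mulm1 mulrC.
Qed.

(** * Quasideterminants of corners of triangular matrices *)

Section Quasideterminants.

Variable R : nzRingType.

Definition has_inv (u : R) := exists v, u * v = 1 /\ v * u = 1.

Lemma has_inv1 : has_inv 1.
Proof. by exists 1; rewrite mulr1. Qed.

Lemma has_invN u : has_inv u -> has_inv (- u).
Proof. by case=> v [uv vu]; exists (- v); rewrite !mulrNN. Qed.

Lemma has_inv_sign m : has_inv ((-1) ^+ m).
Proof. by exists ((-1) ^+ m); rewrite -expr2 sqrr_sign. Qed.

Lemma triangular_inv n (A : 'M[R]_n) :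
    (forall i j : 'I_n, (j < i)%N -> A i j = 0) ->
    (forall i, has_inv (A i i)) ->
  exists M, A *m M = 1%:M /\ M *m A = 1%:M.
Proof.
elim: n A => [|n IHn] A A0 Ainv.
  by exists 1%:M; split; apply/matrixP => -[].
have [v [Av vA]] := Ainv ord0.
pose B := drsubmx (A : 'M_(1 + n)).
have [||M [BM MB]] := IHn B.
- by move=> i j lt_ji; rewrite !mxE A0 //= ltnS.
- by move=> i; rewrite !mxE; apply: Ainv.
pose r := ursubmx (A : 'M_(1 + n)).
have A_block : A = block_mx (A ord0 ord0)%:M r 0 B :> 'M_(1 + n).
  rewrite -[LHS](@submxK _ 1 n 1 n) /r /B; congr (block_mx _ _ _ _).
    apply/matrixP => i j; rewrite !ord1 !mxE eqxx mulr1n.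
    by congr (A _ _); apply: val_inj.
  by apply/matrixP => i j; rewrite !mxE A0 //= ord1.
exists (block_mx v%:M (- (v *: (r *m M))) 0 M : 'M_(1 + n)).
rewrite A_block; split; rewrite (@mulmx_block _ 1 n 1 n 1 n);
  rewrite ?(mul0mx, mulmx0) !(addr0, add0r).
  rewrite -!scalar_mxM Av mulmxN mul_scalar_mx scalerA Av scale1r addNr BM.
  by rewrite -scalar_mx_block.
rewrite -!scalar_mxM vA mulNmx -scalemxAl -mulmxA MB mulmx1 mul_scalar_mx subrr.
by rewrite -scalar_mx_block.
Qed.

Section Corner.

Variables (n : nat) (X : 'M[R]_n.+2).

Hypothesis X_triangular : forall i j : 'I_n.+2, (j < i)%N -> X i j = 0.
Hypothesis X_diag : forall i, i != ord0 -> i != ord_max -> has_inv (X i i).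

(** An upper triangular matrix without its last row and its first column is
    almost triangular, and the minor opposite to the last entry of its first
    row is triangular with the inner diagonal entries of [X] on its diagonal. *)
Definition corner := row' ord_max (col' ord0 X).

Lemma corner_minor_inv : exists M,
  row' ord0 (col' ord_max corner) *m M = 1%:M /\
  M *m row' ord0 (col' ord_max corner) = 1%:M.
Proof.
apply: triangular_inv => [i j lt_ji|i]; rewrite !mxE.
  by apply: X_triangular; rewrite !(lift_max, lift0) ltnS.
have -> : lift ord_max (lift ord0 i) = lift ord0 (lift ord_max i).
  by apply: ord_inj; rewrite !(lift_max, lift0).
apply: X_diag; first by rewrite eq_sym neq_lift.
by rewrite -(inj_eq (@ord_inj _)) lift0 lift_max eqSS ltn_eqF.
Qed.

Lemma big_ord_recr_lift (V : nmodType) m (F : 'I_m.+1 -> V) :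
  \sum_i F i = \sum_i F (lift ord_max i) + F ord_max.
Proof.
rewrite big_ord_recr; congr (_ + _); apply: eq_bigr => i _; congr F.
by apply: ord_inj; rewrite lift_max.
Qed.

(** The conditions on [y] say that its inner part is the solution
    [- r (A^1n)^(-1)] of the linear system that defines the quasideterminant.
    The product with the last row of [X] has to be removed, as that row is not
    in the corner. *)
Lemma corner_quasidet_row (y : 'rV[R]_n.+2) : y 0 ord0 = 1 ->
    (forall j, j != ord0 -> j != ord_max -> (y *m X) 0 j = 0) ->
  is_quasidet corner ord0 ord_max
    ((y *m X) 0 ord_max - y 0 ord_max * X ord_max ord_max).
Proof.
move=> y0 yX0; have [M [AM MA]] := corner_minor_inv; exists M; split=> //.
pose y' : 'rV_n := \row_i y 0 (lift ord_max (lift ord0 i)).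
have yXE (j : 'I_n.+1) : (y *m X) 0 (lift ord0 j) =
    corner ord0 j + \sum_i y' 0 i * corner (lift ord0 i) j
    + y 0 ord_max * X ord_max (lift ord0 j).
  rewrite mxE big_ord_recr_lift big_ord_recl !mxE.
  have -> : lift ord_max ord0 = ord0 :> 'I_n.+2 by apply: val_inj.
  by rewrite y0 mul1r; congr (_ + _ + _); apply: eq_bigr => i _; rewrite !mxE.
have rowE : col' ord_max (row ord0 corner) =
    - y' *m row' ord0 (col' ord_max corner).
  apply/matrixP => i j; rewrite ord1 mulNmx mxE [LHS]mxE [in RHS]mxE.
  apply/eqP; rewrite -addr_eq0; apply/eqP.
  have := yXE (lift ord_max j); rewrite yX0; last first.
  - by rewrite -(inj_eq (@ord_inj _)) lift0 lift_max eqSS ltn_eqF.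
  - by rewrite eq_sym neq_lift.
  rewrite X_triangular; last by rewrite lift0 lift_max ltnS.
  rewrite mulr0 addr0 => e; rewrite [RHS]e [X in _ + X]mxE.
  by congr (_ + _); apply: eq_bigr => i' _; rewrite !mxE.
have -> : col' ord_max (row ord0 corner) *m M = - y'.
  rewrite rowE -mulmxA; apply: etrans (mulmx1 (- y')).
  by congr (_ *m _); apply: AM.
rewrite mulNmx [X in _ = _ - X]mxE opprK.
have eq_max : lift ord0 ord_max = ord_max :> 'I_n.+2 by apply: val_inj.
have := yXE ord_max; rewrite eq_max => ->; rewrite addrK.
congr (_ + _); rewrite [RHS]mxE.
by apply: eq_bigr => i _; rewrite !mxE.
Qed.

(** The mirror image: the inner part of [z] is [- (A^1n)^(-1) c], and the first
    column of [X] is not in the corner. *)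
Lemma corner_quasidet_col (z : 'cV[R]_n.+2) : z ord_max 0 = 1 ->
    (forall i, i != ord0 -> i != ord_max -> (X *m z) i 0 = 0) ->
  is_quasidet corner ord0 ord_max
    ((X *m z) ord0 0 - X ord0 ord0 * z ord0 0).
Proof.
move=> zmax Xz0; have [M [AM MA]] := corner_minor_inv; exists M; split=> //.
rewrite -mulmxA.
pose z' : 'cV_n := \col_i z (lift ord0 (lift ord_max i)) 0.
have XzE (i : 'I_n.+1) : (X *m z) (lift ord_max i) 0 =
    X (lift ord_max i) ord0 * z ord0 0
    + (\sum_j corner i (lift ord_max j) * z' j 0 + corner i ord_max).
  rewrite mxE big_ord_recl big_ord_recr_lift !mxE.
  have -> : lift ord0 ord_max = ord_max :> 'I_n.+2 by apply: val_inj.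
  rewrite zmax mulr1; congr (_ + (_ + _)).
  by apply: eq_bigr => j _; rewrite !mxE.
have colE : row' ord0 (col ord_max corner) =
    - (row' ord0 (col' ord_max corner) *m z').
  apply/matrixP => i j; rewrite ord1 [LHS]mxE [LHS]mxE [RHS]mxE [X in - X]mxE.
  apply/eqP; rewrite -addr_eq0 addrC; apply/eqP.
  have := XzE (lift ord0 i); rewrite Xz0; last first.
  - by rewrite -(inj_eq (@ord_inj _)) lift_max lift0 eqSS ltn_eqF.
  - by rewrite -(inj_eq (@ord_inj _)) lift_max lift0.
  rewrite X_triangular; last by rewrite lift_max lift0.
  rewrite mul0r add0r => e; rewrite [RHS]e.
  by congr (_ + _); apply: eq_bigr => j' _; rewrite !mxE.
have -> : M *m row' ord0 (col ord_max corner) = - z'.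
  rewrite colE mulmxN mulmxA; congr (- _).
  by apply: etrans (mul1mx z'); congr (_ *m _); apply: MA.
rewrite mulmxN [X in _ = _ - X]mxE opprK.
have eq_0 : lift ord_max ord0 = ord0 :> 'I_n.+2 by apply: val_inj.
have := XzE ord0; rewrite eq_0 => ->; rewrite [X in X - _]addrC addrK addrC.
congr (_ + _); rewrite [RHS]mxE.
by apply: eq_bigr => i _; rewrite !mxE.
Qed.

End Corner.

End Quasideterminants.

Lemma has_inv_natr (k : fieldType) (R : lalgType k) m :
  [pchar k] =i pred0 -> has_inv (m.+1%:R : R).
Proof.
move=> k_char0; have m_neq0 : m.+1%:R != 0 :> k by rewrite (pcharf0P k).1.
exists (m.+1%:R^-1 *: 1).
have -> : m.+1%:R = m.+1%:R *: 1 :> R by rewrite scaler_nat.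
by rewrite -!scalerAl !mul1r !scalerA mulfV // mulVf // scale1r.
Qed.

(** * Quasideterminants built from two inverse triangular matrices *)

Section HessenbergCorners.

Variables (R : nzRingType) (n : nat) (E H : 'M[R]_n.+2).

Definition index_mx : 'M[R]_n.+2 := diag_mx (\row_i (i : nat)%:R).

Notation D := index_mx.

Let P := E *m (H *m D - D *m H).

Hypothesis EH : E *m H = 1%:M.
Hypothesis HE : H *m E = 1%:M.
Hypothesis E_lt0 : forall i j : 'I_n.+2, (j < i)%N -> E i j = 0.
Hypothesis H_lt0 : forall i j : 'I_n.+2, (j < i)%N -> H i j = 0.
Hypothesis E_diag : forall i, E i i = 1.
Hypothesis H_diag : forall i, H i i = 1.
Hypothesis inv_nat : forall m, has_inv (m.+1%:R : R).

(** Only the triangular part of [H] contributes, so the weight [j - i] may be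
    read with truncated subtraction. *)
Lemma index_commE i j : (H *m D - D *m H) i j = H i j *+ (j - i).
Proof.
rewrite mul_mx_diag mul_diag_mx !mxE mulr_natr mulr_natl.
have [le_ij|lt_ji] := leqP i j; first by rewrite mulrnBr.
by rewrite H_lt0 // !mul0rn subr0.
Qed.

Lemma conj_index_le0 (i j : 'I_n.+2) : (j <= i)%N -> P i j = 0.
Proof.
move=> le_ji; rewrite mxE big1 // => r _; rewrite index_commE.
have [lt_ri|le_ir] := ltnP r i; first by rewrite E_lt0 ?mul0r.
have /eqP-> : (j - r == 0)%N by rewrite subn_eq0 (leq_trans le_ji).
by rewrite mulr0.
Qed.

(** The next three identities are Newton identities: they relate [P], which
    collects the power sums, to [E] and [H]. *)
Lemma conj_indexE : P = D - E *m D *m H.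
Proof. by rewrite /P mulmxBr !mulmxA EH mul1mx. Qed.

Lemma mul_conj_index : H *m P = H *m D - D *m H.
Proof. by rewrite /P mulmxA HE mul1mx. Qed.

Lemma conj_index_mul : P *m E = D *m E - E *m D.
Proof. by rewrite conj_indexE mulmxBl -!mulmxA HE mulmx1. Qed.

(** The four triangular matrices are chosen so that the matrices of the theorem
    are their corners.  The last column of the first one is that of the
    commutator [H D - D H]; in the second one the weight [j] in row 0 is that of
    [E D]. *)
Definition bordered_A : 'M[R]_n.+2 :=
  \matrix_(i, j) if j == ord_max then H i j *+ (j - i) else H i j.

Definition bordered_B : 'M[R]_n.+2 :=
  \matrix_(i, j)
    ((-1) ^+ (i + j) * (E i j *+ (if i == ord0 then j : nat else 1))).

Lemma quasidet_bordered_A :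
  is_quasidet (corner bordered_A) ord0 ord_max (P ord0 ord_max).
Proof.
pose y := row ord0 E.
have yX j : (y *m bordered_A) 0 j =
    if j == ord_max then P ord0 j else (E *m H) ord0 j.
  rewrite mxE; case: ifP => j_max; rewrite [RHS]mxE; apply: eq_bigr => r _;
    by rewrite ?index_commE !mxE j_max.
have -> : P ord0 ord_max =
    (y *m bordered_A) 0 ord_max - y 0 ord_max * bordered_A ord_max ord_max.
  by rewrite yX !mxE eqxx subnn mulr0n mulr0 subr0.
apply: corner_quasidet_row.
- by move=> i j lt_ji; rewrite mxE H_lt0 // mul0rn; case: ifP.
- move=> i _ /negbTE i_max; rewrite mxE i_max H_diag; exact: has_inv1.
- by rewrite mxE E_diag.
- by move=> j /negbTE j0 /negbTE j_max; rewrite yX j_max EH mxE eq_sym j0.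
Qed.

Lemma quasidet_bordered_B :
  is_quasidet (corner bordered_B) ord0 ord_max ((-1) ^+ n * P ord0 ord_max).
Proof.
pose z := \col_j ((-1) ^+ (n.+1 + j) * H j ord_max).
have Xz i : (bordered_B *m z) i 0 = (-1) ^+ (n.+1 + i) *
    (if i == ord0 then (E *m D *m H) i ord_max else (E *m H) i ord_max).
  have -> : (if i == ord0 then (E *m D *m H) i ord_max
      else (E *m H) i ord_max) =
    \sum_j E i j *+ (if i == ord0 then j : nat else 1) * H j ord_max.
    case: ifP => _; rewrite mxE; apply: eq_bigr => j _ //.
    by rewrite mul_mx_diag !mxE mulr_natr.
  rewrite mxE mulr_sumr; apply: eq_bigr => j _; rewrite !mxE.
  rewrite mulrA -(mulrA ((-1) ^+ (i + j))).
  rewrite (commrX _ (commrN1 _)) mulrA -exprD -mulrA; congr (_ * _).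
  rewrite addnACA exprD -[(-1) ^+ (j + j)]signr_odd addnn odd_double.
  by rewrite mulr1 addnC.
have -> : (-1) ^+ n * P ord0 ord_max =
    (bordered_B *m z) ord0 0 - bordered_B ord0 ord0 * z ord0 0.
  rewrite Xz eqxx [bordered_B _ _]mxE mulr0n mulr0 mul0r subr0.
  have -> : E *m D *m H = D - P by rewrite conj_indexE subKr.
  rewrite addn0 exprS mulN1r mulNr -mulrN; congr (_ * _).
  by rewrite [X in - X]mxE [X in X + _]mxE [X in _ + X]mxE sub0r opprK.
apply: corner_quasidet_col.
- by move=> i j lt_ji; rewrite mxE E_lt0 // mul0rn mulr0.
- move=> i /negbTE i0 _; rewrite mxE i0 E_diag mulr1; exact: has_inv_sign.
- by rewrite mxE H_diag mulr1 -signr_odd addnn odd_double.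
- move=> i /negbTE i0 /negbTE i_max.
  by rewrite Xz i0 EH mxE i_max mulr0.
Qed.

Definition bordered_C : 'M[R]_n.+2 := P - D.

Lemma quasidet_bordered_C :
  is_quasidet (corner bordered_C) ord0 ord_max (H ord0 ord_max *+ n.+1).
Proof.
pose y := row ord0 H.
have yX : y *m bordered_C = 0.
  rewrite /y /bordered_C -row_mul mulmxBr mul_conj_index addrAC subrr add0r.
  by apply/rowP => j; rewrite mul_diag_mx !mxE mul0r oppr0.
have XE i j : bordered_C i j = P i j - i%:R *+ (i == j) by rewrite !mxE.
have -> : H ord0 ord_max *+ n.+1 =
    (y *m bordered_C) 0 ord_max - y 0 ord_max * bordered_C ord_max ord_max.
  rewrite yX XE conj_index_le0 // !mxE eqxx !sub0r mulrN opprK.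
  exact: esym (mulr_natr _ _).
apply: corner_quasidet_row.
- move=> i j lt_ji; rewrite XE conj_index_le0 1?ltnW //.
  by rewrite -val_eqE /= gtn_eqF // subr0.
- move=> i i0 _; rewrite XE conj_index_le0 // eqxx sub0r.
  rewrite -(@prednK i) ?lt0n //; apply: has_invN; exact: inv_nat.
- by rewrite mxE H_diag.
- by move=> j _ _; rewrite yX mxE.
Qed.

Definition bordered_D : 'M[R]_n.+2 := P + (n.+1%:R%:M - D).

Lemma quasidet_bordered_D :
  is_quasidet (corner bordered_D) ord0 ord_max (- (E ord0 ord_max *+ n.+1)).
Proof.
pose z := col ord_max E.
have Xz : bordered_D *m z = 0.
  rewrite /z colE mulmxA -colE mulmxDl conj_index_mul mulmxBl.
  apply/colP => i; rewrite mul_diag_mx mul_mx_diag mul_scalar_mx !mxE.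
  by rewrite !mulr_natr !mulr_natl addrC subrKA subrr.
have XE i j : bordered_D i j = P i j + (n.+1%:R *+ (i == j) - i%:R *+ (i == j)).
  by rewrite !mxE.
have -> : - (E ord0 ord_max *+ n.+1) =
    (bordered_D *m z) ord0 0 - bordered_D ord0 ord0 * z ord0 0.
  rewrite Xz XE conj_index_le0 // !mxE eqxx sub0r subr0 add0r; congr (- _).
  exact: esym (mulr_natl _ _).
apply: corner_quasidet_col.
- move=> i j lt_ji; rewrite XE conj_index_le0 1?ltnW //.
  by rewrite -val_eqE /= gtn_eqF // subr0 addr0.
- move=> i _ i_max; rewrite XE conj_index_le0 // eqxx add0r.
  have lt_iN : (i < n.+1)%N by rewrite ltn_neqAle -ltnS ltn_ord andbT.
  rewrite !mulr1n -natrB ?(ltnW lt_iN) // -(subnSK lt_iN).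
  exact: inv_nat.
- by rewrite mxE E_diag.
- by move=> i _ _; rewrite Xz mxE.
Qed.

End HessenbergCorners.

(** * The shifted families as matrices of multiplications *)

Section ShiftedFamilies.

Variables (k : fieldType) (a : int -> k) (L : nat -> Sym k).
Variables (SS LL : int -> nat -> Sym k) (n : nat).
Hypothesis L_def : is_Lambda a L.
Hypothesis SS_def : is_S_shift a SS.
Hypothesis LL_def : is_Lambda_shift a L LL.

Let N := n.+1.
(** With this choice of linear factors, the index [j] of a matrix stands for
    the integer [j - N], so that the last index is the integer 0 and the
    unshifted Lambda and Psi lie in the last column. *)
Let w (l : nat) : k := a (l%:Z + 1 - N%:Z).
Let sigma : ser (Sym k) := fall_ser a (@Sgen k).
Let lambda : ser (Sym k) := ser_opp_var (fall_ser (hat a) L).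

Definition sigma_mx := ser_mx w N.+1 sigma.
Definition lambda_mx := ser_mx w N.+1 lambda.
Local Notation D := (index_mx (Sym k) n).

Lemma lambda_sigma_mx : lambda_mx *m sigma_mx = 1%:M.
Proof.
have [_ LS _] := L_def.
rewrite -ser_mxM; last exact: malg_scalerAr.
by rewrite (eq_ser_mx _ _ LS) ser_mx1.
Qed.

Lemma sigma_lambda_mx : sigma_mx *m lambda_mx = 1%:M.
Proof.
have [_ _ SL] := L_def.
rewrite -ser_mxM; last exact: malg_scalerAr.
by rewrite (eq_ser_mx _ _ SL) ser_mx1.
Qed.

Lemma fall_ser_const b (f : nat -> Sym k) : fall_ser b f 0%N = f 0%N.
Proof. by rewrite fall_serE big_ord0 add0r. Qed.

Lemma sigma_coef0 : sigma 0%N = 1.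
Proof. exact: fall_ser_const. Qed.

Lemma lambda_coef0 : lambda 0%N = 1.
Proof.
have [L0 _ _] := L_def.
by rewrite /lambda /ser_opp_var mul1r fall_ser_const L0.
Qed.

Lemma residue_fall_ser b (f : nat -> Sym k) F (s : seq k) m :
    fall_ser b f =1 F -> s = [seq b l.+1%:Z | l <- iota 0 m] ->
  f m.+1 = residue s F.
Proof. by move=> fF ->; rewrite [LHS](fall_ser_coef b); apply: eq_mulXsubs. Qed.

(** Both sides are the residue of sigma against the same linear factors. *)
Lemma ser_entry_sigma i j : (i <= j)%N ->
  ser_entry w sigma i j = SS (N%:Z - i%:Z - 1) (j - i).
Proof.
rewrite leq_eqVlt => /predU1P[->|lt_ij].
  rewrite ser_entry_diag subnn; apply: etrans (fall_ser_const _ _).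
  exact/esym/SS_def.
rewrite /ser_entry lt_ij -subnSK //; apply/esym/(residue_fall_ser (SS_def _)).
rewrite /window -[in X in iota X _](addn0 i.+1) iotaDl -map_comp.
by apply: eq_map => l /=; rewrite /w /tau; congr a; lia.
Qed.

(** The residue of lambda in its falling powers involves the opposites of the
    linear factors of the entry, in reverse order; the substitution of [-t] for
    [t] accounts for the signs. *)
Lemma ser_entry_lambda i j : (i <= j)%N -> (j <= N)%N ->
  ser_entry w lambda i j = (-1) ^+ (j - i) * LL (N%:Z - j%:Z) (j - i).
Proof.
rewrite leq_eqVlt => /predU1P[-> _|lt_ij le_jN].
  rewrite ser_entry_diag subnn; congr (_ * _).
  apply: etrans (fall_ser_const _ _); exact/esym/LL_def.
rewrite /ser_entry lt_ij /residue (mulXsubs_opp_var (@malg_scalerAr k _)).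
rewrite size_map size_iota addn1 (subnSK lt_ij); congr (_ * _).
rewrite -mulXsubs_rev -(subnSK lt_ij).
apply/esym/(residue_fall_ser (LL_def _)); rewrite /window -map_comp -map_rev.
apply: (@eq_from_nth _ 0) => [|l].
  by rewrite !size_map size_rev !size_iota.
rewrite size_map size_rev size_iota => lt_l.
rewrite (nth_map 0%N) ?size_rev ?size_iota // nth_rev ?size_iota //.
rewrite (nth_map 0%N) ?size_iota // !nth_iota ?size_iota //; last by lia.
by rewrite /= /w /tau /hat; congr (- a _); lia.
Qed.

Lemma sigma_mx_lt0 (i j : 'I_n.+2) : (j < i)%N -> sigma_mx i j = 0.
Proof. by move=> lt_ji; rewrite mxE ser_entry_lt0. Qed.

Lemma lambda_mx_lt0 (i j : 'I_n.+2) : (j < i)%N -> lambda_mx i j = 0.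
Proof. by move=> lt_ji; rewrite mxE ser_entry_lt0. Qed.

Lemma sigma_mx_diag (i : 'I_n.+2) : sigma_mx i i = 1.
Proof. by rewrite mxE ser_entry_diag sigma_coef0. Qed.

Lemma lambda_mx_diag (i : 'I_n.+2) : lambda_mx i i = 1.
Proof. by rewrite mxE ser_entry_diag lambda_coef0. Qed.

(** The defining sum of a power sum is the matrix product of [lambda_mx] with
    the commutator, the weights [n - k] being those of [index_commE]. *)
Lemma conj_index_Psi (i j : 'I_n.+2) :
  (lambda_mx *m (sigma_mx *m D - D *m sigma_mx)) i j =
  Psi SS LL (N%:Z - (j : nat)%:Z) (j - i).
Proof.
apply/esym; rewrite [RHS]mxE.
under [RHS]eq_bigr => r _ do rewrite (index_commE sigma_mx_lt0) !mxE.
have le_jN : (j <= N)%N by rewrite -ltnS.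
rewrite (@big_ord_support _ _ i j (fun r => ser_entry w lambda i r *
  (ser_entry w sigma r j *+ (j - r)))) ?(leqW le_jN) //.
  apply: eq_bigr => r _; have lt_r := ltn_ord r.
  have le_irj : (i + r <= j)%N by lia.
  rewrite ser_entry_lambda ?leq_addr ?(leq_trans le_irj) // ser_entry_sigma //.
  have assoc (R : nzRingType) (u v x : R) m :
      u * v * (x *+ m) = u * (v * x) *+ m.
    by rewrite mulrnAr mulrA.
  rewrite assoc addKn subnDA.
  have -> : N%:Z - (i + r)%N%:Z = (j - i)%N%:Z - r%:Z + (N%:Z - j%:Z) by lia.
  by have -> : (j - i)%N%:Z - r%:Z + (N%:Z - j%:Z) - 1 =
    (j - i)%N%:Z - r%:Z - 1 + (N%:Z - j%:Z) by lia.
move=> r /orP[lt_ri|le_jr]; first by rewrite ser_entry_lt0 ?mul0r.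
by rewrite (eqP le_jr) mulr0n mulr0.
Qed.

Lemma Lambda_unshifted m : LL 0 m.+1 = L m.+1.
Proof.
apply: etrans (residue_fall_ser (LL_def _) (erefl _)) _.
apply/esym/(residue_fall_ser (frefl _)).
by apply: eq_map => l; rewrite /tau addr0.
Qed.

End ShiftedFamilies.

(** * The four matrices as corners *)

Section Corners.

Variables (k : fieldType) (a : int -> k) (L : nat -> Sym k).
Variables (SS LL : int -> nat -> Sym k) (n : nat).
Hypothesis L_def : is_Lambda a L.
Hypothesis SS_def : is_S_shift a SS.
Hypothesis LL_def : is_Lambda_shift a L LL.

Local Notation H := (sigma_mx a n).
Local Notation E := (lambda_mx a L n).

Lemma cornerE (R : Type) (X : 'M[R]_n.+2) (i j : 'I_n.+1) :
  row' ord_max (col' ord0 X) i j = X (lift ord_max i) (lift ord0 j).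
Proof. by rewrite !mxE. Qed.

Lemma matA_corner : matA SS n.+1 = corner (bordered_A H).
Proof.
apply/matrixP => i j; rewrite cornerE [LHS]mxE [RHS]mxE [H _ _]mxE.
rewrite -(inj_eq (@ord_inj _)) !lift0 lift_max /= !eqSS ltnS.
have [le_ij|lt_ji] := leqP i j.
  rewrite (ser_entry_sigma _ SS_def) ?(leqW le_ij) //.
  rewrite !subSS !addn1 (subSn le_ij).
  have -> : n.+1%:Z - (i : nat)%:Z - 1 = n.+1%:Z - i.+1%:Z by lia.
  by case: eqP => [->|_].
rewrite [j == n :> nat]ltn_eqF; last by rewrite (leq_trans lt_ji) // -ltnS.
have [eq_ij|ne_ij] := eqVneq (i : nat) j.+1.
  by rewrite -eq_ij ser_entry_diag sigma_coef0.
by rewrite ser_entry_lt0 // ltn_neqAle eq_sym ne_ij.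
Qed.

Lemma matB_corner : matB LL n.+1 = corner (bordered_B E).
Proof.
apply/matrixP => i j; rewrite cornerE [LHS]mxE [RHS]mxE [E _ _]mxE.
rewrite -(inj_eq (@ord_inj _)) !lift0 lift_max /= !eqSS ltnS.
have lt_j := ltn_ord j.
have [le_ij|lt_ji] := leqP i j.
  rewrite (ser_entry_lambda LL_def) ?(leqW le_ij) // subSS addn1 (subSn le_ij).
  have sign2 : (-1) ^+ (i + j.+1) * (-1) ^+ (j - i).+1 = 1 :> Sym k.
    have -> : (i + j.+1)%N = (i.*2 + (j - i).+1)%N.
      by rewrite -addnn -addnA -(subSn le_ij) subnKC ?(leqW le_ij).
    by rewrite exprD -signr_odd odd_double mul1r -expr2 sqrr_sign.
  rewrite -mulrnAr mulrA sign2 mul1r.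
  by case: eqP => [->|_]; rewrite ?subn0.
have [eq_ij|ne_ij] := eqVneq (i : nat) j.+1.
  rewrite -eq_ij ser_entry_diag lambda_coef0 // eq_ij mulr1n mulr1.
  by rewrite -signr_odd addnn odd_double.
by rewrite ser_entry_lt0 ?mul0rn ?mulr0 // ltn_neqAle eq_sym ne_ij.
Qed.

Lemma index_mxE (R : nzRingType) (i j : 'I_n.+2) :
  index_mx R n i j = i%:R *+ (i == j :> nat).
Proof. by rewrite !mxE. Qed.

Lemma matC_corner : matC SS LL n.+1 = corner (bordered_C E H).
Proof.
apply/matrixP => i j; rewrite cornerE [LHS]mxE [RHS]mxE [X in _ = _ + X]mxE.
rewrite (conj_index_Psi SS_def LL_def) index_mxE !lift0 lift_max eqSS ltnS.
have [le_ij|lt_ji] := leqP i j.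
  by rewrite subSS addn1 (subSn le_ij) ltn_eqF ?ltnS // subr0.
have /eqP-> : (j.+1 - i == 0)%N by rewrite subn_eq0.
rewrite /Psi big_ord0 sub0r.
by case: eqP => [->|_] //; rewrite oppr0.
Qed.

Lemma matD_corner : matD SS LL n.+1 = corner (bordered_D E H).
Proof.
apply/matrixP => i j; rewrite cornerE [LHS]mxE [RHS]mxE [X in _ = _ + X]mxE.
rewrite (conj_index_Psi SS_def LL_def).
rewrite [X in _ = _ + (X + _)]mxE [X in _ = _ + (_ + X)]mxE index_mxE.
rewrite -(inj_eq (@ord_inj _)) !lift0 lift_max eqSS ltnS.
have [le_ij|lt_ji] := leqP i j.
  by rewrite subSS addn1 (subSn le_ij) ltn_eqF ?ltnS // subr0 addr0.
have /eqP-> : (j.+1 - i == 0)%N by rewrite subn_eq0.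
rewrite /Psi big_ord0 add0r.
case: eqP => [->|_]; last by rewrite subr0.
by rewrite natrB // ltn_ord.
Qed.

End Corners.

(* The size [n >= 1] is written [n.+1]. *)
Theorem proposition39 (k : fieldType) (k_char0 : [pchar k] =i pred0)
    (a : int -> k) (L : nat -> Sym k) (SS LL : int -> nat -> Sym k)
    (L_def : is_Lambda a L) (SS_def : is_S_shift a SS)
    (LL_def : is_Lambda_shift a L LL) (n : nat) :
  [/\ is_quasidet (matA SS n.+1) ord0 ord_max (Psi SS LL 0 n.+1),
      exists2 d, is_quasidet (matB LL n.+1) ord0 ord_max d &
        Psi SS LL 0 n.+1 = (-1) ^+ n * d,
      is_quasidet (matC SS LL n.+1) ord0 ord_max (SS n%:Z n.+1 *+ n.+1) &
      exists2 d, is_quasidet (matD SS LL n.+1) ord0 ord_max d &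
        L n.+1 *+ n.+1 = (-1) ^+ n * d].
Proof.
have EH := lambda_sigma_mx n L_def; have HE := sigma_lambda_mx n L_def.
have E0 := @lambda_mx_lt0 k a L n; have H0 := @sigma_mx_lt0 k a n.
have E1 := @lambda_mx_diag k a L n L_def; have H1 := @sigma_mx_diag k a n.
have inv_nat m := has_inv_natr (Sym k) m k_char0.
have PsiE := conj_index_Psi SS_def LL_def (ord0 : 'I_n.+2) ord_max.
have max0 : n.+1%:Z - (ord_max : 'I_n.+2)%:Z = 0 by apply: subrr.
rewrite max0 (subn0 (ord_max : 'I_n.+2)) in PsiE.
split.
- rewrite (matA_corner _ SS_def) -PsiE.
  exact: (quasidet_bordered_A EH H0 E1 H1).
- exists ((-1) ^+ n * Psi SS LL 0 n.+1).
    rewrite (matB_corner n L_def LL_def) -PsiE.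
    exact: (quasidet_bordered_B EH E0 E1 H1).
  by rewrite mulrA -expr2 sqrr_sign mul1r.
- rewrite (matC_corner n SS_def LL_def).
  have -> : SS n n.+1 = sigma_mx a n ord0 ord_max.
    have -> : n%:Z = n.+1%:Z - 0%N%:Z - 1 by lia.
    by rewrite mxE (ser_entry_sigma _ SS_def) // subn0.
  exact: (quasidet_bordered_C HE E0 H0 H1 inv_nat).
- exists (- (lambda_mx a L n ord0 ord_max *+ n.+1)).
    rewrite (matD_corner n SS_def LL_def).
    exact: (quasidet_bordered_D EH HE E0 H0 E1 inv_nat).
  rewrite mxE (ser_entry_lambda LL_def) // subn0 subrr.
  rewrite (Lambda_unshifted LL_def).
  rewrite -mulrnAr exprS mulN1r mulNr opprK.
  by rewrite mulrA -expr2 sqrr_sign mul1r.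
Qed.
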